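(* Let $I$ and $J$ be generalized Boolean pseudolattices, $X=\Theta^a_g(I)$ and $F=\Theta^a_g(J)$. Then $F$ is homeomorphic to a regular closed subset of $X$ if and only if there exists a surjective $\{0\}$-pseudolattice homomorphism $\varphi:I\to J$ which preserves all meets that happen to exist in $I$.
   Context: A pseudolattice is a poset having all finite non-empty meets and joins; a $\{0\}$-pseudolattice is a pseudolattice with a least element $0$. A distributive $\{0\}$-pseudolattice $I$ is a generalized Boolean pseudolattice if for all $a,b,c\in I$ with $b\le a\le c$ there exists $x\in I$ with $a\wedge x=b$ and $a\vee x=c$. A $\{0\}$-pseudolattice homomorphism preserves $0$ and binary meets and joins. ''Preserves all meets that happen to exist'' means: if a family $\{a_i\}$ in $I$ has a meet $a$ in $I$, then $\{\varphi(a_i)\}$ has a meet in $J$, equal to $\varphi(a)$. For a generalized Boolean pseudolattice $I$, $Idl(I)$ is the frame of ideals of $I$, and for $K\in Idl(I)$, $\neg K=\{a\in I : a\wedge b=0\ \text{for all } b\in K\}$; $K$ is simple if $K\vee\neg K=I$ in $Idl(I)$. The set $Si(I)$ of simple ideals is a Boolean algebra under the lattice operations of $Idl(I)$, and every principal ideal $\downarrow a=\{b\in I : b\le a\}$, $a\in I$, is simple. $\Theta^a_g(I)$ is the dual space of $I$: the set of all ultrafilters $u$ of the Boolean algebra $Si(I)$ which contain some principal ideal $\downarrow a$ ($a\in I$), with the topology having as a base the sets $\{u : K\in u\}$, $K\in Si(I)$ (a zero-dimensional locally compact Hausdorff space). A subset $F$ of $X$ is regular closed if $F=\mathrm{cl}(\mathrm{int}(F))$.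 *)

(* Defs.v *)
From HB Require Import structures.
From mathcomp Require Import all_boot all_order.
From mathcomp Require Import all_classical topology.

Set Implicit Arguments.
Unset Strict Implicit.
Unset Printing Implicit Defensive.

Import Order.Theory.

Local Open Scope classical_set_scope.

Section GeneralizedBoolean.
Context (d : Order.disp_t) (I : bDistrLatticeType d).
Local Open Scope order_scope.

Definition generalized_boolean : Prop :=
  forall a b c : I, b <= a -> a <= c -> exists x : I, a `&` x = b /\ a `|` x = c.

End GeneralizedBoolean.

Section DualSpace.
Context (d : Order.disp_t) (I : bDistrLatticeType d).

Definition ideal (K : set I) : Prop :=
  [/\ K \bot%O,
      forall a b : I, (b <= a)%O -> K a -> K b &
      forall a b : I, K a -> K b -> K (a `|` b)%O].

(* Idl(I) is the set of ideals ordered by inclusion: its meets are the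
   intersections, its least element is [set \bot], its greatest element is
   setT, and the join of two ideals is the least ideal containing both. *)
Definition ideal_join (K L : set I) : set I := smallest ideal (K `|` L).

Definition ideal_neg (K : set I) : set I :=
  [set a | forall b, K b -> (a `&` b)%O = \bot%O].

Definition simple_ideal (K : set I) : Prop :=
  ideal K /\ ideal_join K (ideal_neg K) = [set: I].

Definition principal_ideal (a : I) : set I := [set b | (b <= a)%O].

(* Si(I) is a sublattice of Idl(I), so its order is inclusion, its meet is
   intersection and its bounds are [set \bot] and setT; a filter of Si(I) is
   encoded as a set of subsets of I all of which are simple ideals. *)
Definition simple_filter (u : set (set I)) : Prop :=
  [/\ u `<=` simple_ideal,
      u [set: I],
      forall K L, u K -> u L -> u (K `&` L) &
      forall K L, u K -> simple_ideal L -> K `<=` L -> u L].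

Definition simple_proper_filter (u : set (set I)) : Prop :=
  simple_filter u /\ ~ u [set \bot%O].

Definition simple_ultrafilter (u : set (set I)) : Prop :=
  simple_proper_filter u /\
  forall v, simple_proper_filter v -> u `<=` v -> v = u.

Record dual_space : Type := DualPoint {
  dual_point :> set (set I);
  dual_pointP : simple_ultrafilter dual_point /\
                exists a : I, dual_point (principal_ideal a) }.

Definition dual_basic (K : set I) : set dual_space :=
  [set u : dual_space | dual_point u K].

Lemma dual_basic_cover : \bigcup_(K in simple_ideal) dual_basic K = setT.
Proof.
apply/seteqP; split=> // u _; have [[[[uS uT _ _] _] _] _] := dual_pointP u.
by exists setT => //; exact: uS.
Qed.

Lemma dual_basic_join (K L : set I) (u : dual_space) :
  simple_ideal K -> simple_ideal L -> dual_basic K u -> dual_basic L u ->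
  exists M, [/\ simple_ideal M, dual_basic M u &
                dual_basic M `<=` dual_basic K `&` dual_basic L].
Proof.
move=> sK sL uK uL; have [[[[uS _ uI _] _] _] _] := dual_pointP u.
exists (K `&` L); split; [exact/uS/uI|exact: uI|].
move=> v vKL; have [[[[_ _ _ vup] _] _] _] := dual_pointP v.
by split; apply: (vup _ _ vKL) => // x [].
Qed.

HB.instance Definition _ := gen_eqMixin dual_space.
HB.instance Definition _ := gen_choiceMixin dual_space.
HB.instance Definition _ := isBaseTopological.Build dual_space
  dual_basic_cover dual_basic_join.

End DualSpace.

Definition homeomorphic (S T : topologicalType) : Prop :=
  exists (f : S -> T) (g : T -> S),
    [/\ cancel f g, cancel g f, continuous f & continuous g].

(* A family enters a meet only through its range, so families are sets. *)
Definition preserves_existing_meets (d d' : Order.disp_t)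
    (I : bDistrLatticeType d) (J : bDistrLatticeType d') (phi : I -> J) : Prop :=
  forall (A : set I) (a : I), infimums A a -> infimums (phi @` A) (phi a).

(* Main.v *)
Require Import Defs.
From HB Require Import structures.
From mathcomp Require Import all_boot all_order.
From mathcomp Require Import all_classical topology.

Set Implicit Arguments.
Unset Strict Implicit.
Unset Printing Implicit Defensive.

(** The theorem is an instance of Stone duality.  Sending a point [u] of the
    dual space to the set of the [a] with [principal_ideal a] in [u] identifies
    the dual space of a generalized Boolean pseudolattice with its space of
    prime filters, topologized by the basic sets D(a) of the filters that
    contain [a]: a simple ideal meets the part below [a] in a principal ideal,
    so that an ultrafilter of simple ideals containing a principal ideal is
    determined by the principal ideals in it.  By the prime ideal theorem,
    [a <= b] iff D(a) is included in D(b), and each D(a) is compact, in the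
    form: if D(a) is covered by the D(b) for [b] in an ideal, then [a] lies in
    that ideal ([exists_point_avoiding]).

    Suppose that [e] embeds the dual [Y] of [J] in the dual [X] of [I], with
    regular closed range.  As the range is closed, the preimage under [e] of
    D(a) is a compact open set, that is, some D(b); as [e] is an embedding,
    each D(b) arises in this way; so [a |-> b] is a surjective homomorphism
    [phi].  Let [a] be the meet of [A].  If a lower bound [b] of [phi @` A] were
    not below [phi a], the nonempty D(b) - D(phi a) would be an open set of [Y],
    and, the range of [e] being the closure of its interior, its image would
    contain a nonempty D(x) of [X].  Then [x] is a lower bound of [A], hence is
    below [a], whereas D(x) is disjoint from D(a).

    Conversely, a surjective homomorphism [phi] yields the map
    [v |-> phi @^-1` v] on prime filters.  It is an embedding, and its range is
    the closed set of the filters that avoid the kernel of [phi].  If [phi]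
    preserves meets, this set is regular closed: should the interior of the
    range miss D(a) for some [a], no nonzero element below [a] would be disjoint
    from the whole kernel, so that the meet of the differences of [a] with the
    kernel elements would be [\bot]; but [phi] sends all these differences to [phi a], whence
    [phi a = \bot] and the range misses D(a) altogether. *)

Import Order.Theory.

Local Open Scope classical_set_scope.
Local Open Scope order_scope.

(** * Prime filters and simple ideals *)

Section PrimeFilters.
Context (d : Order.disp_t) (I : bDistrLatticeType d).
Implicit Types (a b c : I) (K L P : set I).

Definition prime_filter P :=
  [/\ exists a, P a, ~ P \bot,
      forall a b, a <= b -> P a -> P b,
      forall a b, P a -> P b -> P (a `&` b) &
      forall a b, P (a `|` b) -> P a \/ P b].

Lemma ideal_principal a : ideal (principal_ideal a).
Proof.
split; rewrite /principal_ideal /=; first exact: le0x.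
- by move=> b c; apply: le_trans.
- by move=> b c ba ca; rewrite leUx ba ca.
Qed.

(** Zorn's lemma is applied to the sets whose union with [B] is an ideal, so
    that the empty chain is bounded by [B] itself. *)
Lemma maximal_ideal_avoiding (B : set I) a : ideal B -> ~ B a ->
  exists M, [/\ ideal M, B `<=` M, ~ M a &
    forall N, ideal N -> M `<=` N -> ~ N a -> N `<=` M].
Proof.
move=> idB nBa.
pose Q (A : set I) := ideal (A `|` B)%classic /\ ~ (A `|` B)%classic a.
have [|A [[idA nAa] maxA]] := @Zorn_bigcup I Q.
  move=> F FQ Ftot; split; last first.
    by case=> [[A FA Aa]|//]; have [_] := FQ _ FA; apply; left.
  have [B0 Ble BU] := idB; split; first by right.
    move=> x y yx [[A FA Ax]|Bx]; last by right; apply: Ble Bx.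
    have [[_ Ale _] _] := FQ _ FA.
    by have [||] := Ale x y yx _; [left|move=> ?; left; exists A|right].
  have join_in A x y : F A -> (A `|` B)%classic x -> (A `|` B)%classic y ->
      (\bigcup_(X in F) X `|` B)%classic (x `|` y).
    move=> FA Ax Ay; have [[_ _ AU] _] := FQ _ FA.
    by case: (AU _ _ Ax Ay) => ?; [left; exists A|right].
  move=> x y [[A FA Ax]|Bx] [[A' FA' Ay]|By].
  - have [AA'|A'A] := Ftot _ _ FA FA'.
    + by apply: (join_in A') => //; left; [exact: AA'|].
    + by apply: (join_in A) => //; left; [|exact: A'A].
  - by apply: (join_in A) => //; [left|right].
  - by apply: (join_in A') => //; [right|left].
  - by right; apply: BU.
exists (A `|` B)%classic; split=> // N idN ABN nNa x Nx; apply: contrapT => nABx.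
have NB : (N `|` B)%classic = N.
  by apply/seteqP; split=> [y [//|By]|y ?]; [apply: ABN; right|left].
apply: (maxA N); last by rewrite /Q NB.
split=> [y Ay|NA]; first by apply: ABN; left.
by apply: nABx; left; apply: NA.
Qed.

(** The prime ideal theorem for distributive lattices: the complement of an
    ideal maximal among those avoiding [a] is a prime filter, since adjoining
    to that ideal an element outside it must capture [a]. *)
Lemma prime_filter_exists (B : set I) a : ideal B -> ~ B a ->
  exists P, [/\ prime_filter P, P a & P `&` B = set0]%classic.
Proof.
move=> idB nBa; have [M [idM BM nMa maxM]] := maximal_ideal_avoiding idB nBa.
have [M0 Mle MU] := idM.
pose adj x := [set z : I | exists2 m, M m & z <= x `|` m].
have adjP x : ~ M x -> exists2 m, M m & a <= x `|` m.
  move=> nMx; apply: contrapT => nadj; apply: nMx; apply: (maxM (adj x)) => //.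
  - split; first by exists \bot => //; exact: le0x.
    + by move=> y z zy [m Mm ym]; exists m => //; apply: le_trans ym.
    + move=> y z [m Mm ym] [n Mn zn]; exists (m `|` n); first exact: MU.
      rewrite leUx (le_trans ym) ?(le_trans zn) ?leU2 ?leUl ?leUr //.
  - by move=> y My; exists y => //; exact: leUr.
  - by exists \bot => //; exact: leUl.
exists (~` M)%classic; split=> //; last first.
  by apply/seteqP; split=> // x [nMx /BM].
split; first by exists a.
- by apply.
- by move=> x y xy nMx /(Mle _ _ xy).
- move=> x y /adjP[m Mm am] /adjP[n Mn an] Mxy; apply: nMa.
  apply: (Mle ((x `&` y) `|` (m `|` n))); last exact/MU/MU.
  rewrite joinIl lexI; apply/andP; split.
    by apply: (le_trans am); rewrite joinA leUl.
  by apply: (le_trans an); rewrite [m `|` n]joinC joinA leUl.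
- move=> x y nMxy; have [Mx|] := pselect (M x); last by left.
  by right=> My; apply: nMxy; apply: MU.
Qed.

(** Distributivity makes the sums of two ideals downward closed. *)
Lemma ideal_joinE K L : ideal K -> ideal L ->
  ideal_join K L = [set a | exists k l, [/\ K k, L l & a = k `|` l]].
Proof.
move=> [K0 Kle KU] [L0 Lle LU]; apply/seteqP; split=> x; last first.
  case=> k [l [Kk Ll ->]] M [[_ _ MU] KLM].
  by apply: MU; apply: KLM; [left|right].
move=> /(_ [set a | exists k l, [/\ K k, L l & a = k `|` l]]); apply; split.
  split; first by exists \bot, \bot; rewrite joinxx.
  - move=> a b ba [k [l [Kk Ll aE]]]; exists (b `&` k), (b `&` l); split.
    + by apply: Kle Kk; exact: leIr.
    + by apply: Lle Ll; exact: leIr.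
    + by rewrite -meetUr -aE (meet_idPl ba).
  - move=> _ _ [k [l [Kk Ll ->]]] [k' [l' [Kk' Ll' ->]]].
    exists (k `|` k'), (l `|` l'); rewrite joinACA.
    by split=> //; [apply: KU|apply: LU].
move=> y [Ky|Ly]; first by exists y, \bot; rewrite joinx0.
by exists \bot, y; rewrite join0x.
Qed.

Lemma ideal_ideal_neg K : ideal (ideal_neg K).
Proof.
split=> [b _|a b ba Ka c Kc|a b Ka Kb c Kc]; first exact: meet0x.
  by apply/eqP; rewrite -lex0 -(Ka _ Kc) leI2.
by rewrite meetUl Ka // Kb // joinxx.
Qed.

(** A simple ideal splits every element into a part in it and a part disjoint
    from it; simple ideals are handled below through this splitting. *)
Lemma simple_idealP K : simple_ideal K <->
  ideal K /\ forall a, exists k n, [/\ K k, ideal_neg K n & a = k `|` n].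
Proof.
split=> -[idK KT]; split=> //; have idN := ideal_ideal_neg K.
  by move=> a; have: [set: I] a by []; rewrite -KT ideal_joinE.
rewrite ideal_joinE//.
by apply/seteqP; split=> // a _; apply: KT.
Qed.

Lemma ideal_negS K L : K `<=` L -> ideal_neg L `<=` ideal_neg K.
Proof. by move=> KL x Lx b /KL; apply: Lx. Qed.

Lemma idealI K L : ideal K -> ideal L -> ideal (K `&` L)%classic.
Proof.
move=> [K0 Kle KU] [L0 Lle LU]; split=> //.
  by move=> a b ba [Ka La]; split; [apply: Kle Ka|apply: Lle La].
by move=> a b [Ka La] [Kb Lb]; split; [apply: KU|apply: LU].
Qed.

Lemma simple_idealI K L :
  simple_ideal K -> simple_ideal L -> simple_ideal (K `&` L)%classic.
Proof.
move=> /simple_idealP[idK sK] /simple_idealP[idL sL]; apply/simple_idealP.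
split=> [|a]; first exact: idealI.
have [k [n [Kk nn ->]]] := sK a; have [l [m [Ll nm kE]]] := sL k.
have [_ _ nU] := ideal_ideal_neg (K `&` L)%classic.
exists l, (m `|` n); split; last by rewrite joinA -kE.
- by split=> //; have [_ + _] := idK; apply; [|exact: Kk]; rewrite kE leUl.
- apply: nU; [move: m nm {kE}|move: n nn]; apply: ideal_negS => ? [] //.
Qed.

Lemma simple_ideal_neg K : simple_ideal K -> simple_ideal (ideal_neg K).
Proof.
move=> /simple_idealP[idK sK]; apply/simple_idealP.
split=> [|a]; first exact: ideal_ideal_neg.
have [k [n [Kk nn aE]]] := sK a; exists n, k; split=> //; last by rewrite joinC.
by move=> b nb; rewrite meetC nb.
Qed.

Lemma simple_idealT : simple_ideal [set: I].
Proof.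
apply/simple_idealP; split=> [//|a]; exists a, \bot; rewrite joinx0; split=> //.
by move=> b _; rewrite meet0x.
Qed.

End PrimeFilters.

(** * Points of the dual space as prime filters *)

Section Points.
Context (d : Order.disp_t) (I : bDistrLatticeType d).
Hypothesis hI : generalized_boolean I.
Implicit Types (a b c : I) (K L P : set I) (u v : dual_space I).

(** The difference of [a] and [b]: a complement of [a `&` b] below [a]. *)
Lemma relative_complement a b :
  exists c, [/\ c <= a, c `&` b = \bot & a = (a `&` b) `|` c].
Proof.
have [||c [ca cU]] := hI (a := a `&` b) (b := \bot) (c := a).
- exact: le0x.
- exact: leIl.
have c_le : c <= a by rewrite -cU leUr.
by exists c; split=> //; rewrite -ca -meetA (meetC b) meetA (meet_idPr c_le).
Qed.

Lemma simple_principal a : simple_ideal (principal_ideal a).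
Proof.
apply/simple_idealP; split=> [|b]; first exact: ideal_principal.
have [c [_ ca bE]] := relative_complement b a.
exists (b `&` a), c; split=> //; first exact: leIr.
by move=> e ea; apply/eqP; rewrite -lex0 -ca leI2.
Qed.

Definition in_point u : set I := [set a | dual_point u (principal_ideal a)].

(** A point is determined by the principal ideals in it: if [K] and
    [principal_ideal a] are in [u], then so is their intersection, which is the
    principal ideal of the part of [a] in [K]. *)
Lemma dual_pointE u K :
  dual_point u K <-> simple_ideal K /\ exists2 a, K a & in_point u a.
Proof.
have [[[[uS uT uI uup] u0] _] [a ua]] := dual_pointP u; split; last first.
  move=> [sK [b Kb ub]]; apply: (uup _ _ ub sK) => c cb.
  by have [[_ Kle _] _] := sK; apply: Kle Kb.
move=> uK; have sK := uS _ uK; split=> //.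
have /simple_idealP[[_ Kle _] +] := sK => /(_ a)[k [n [Kk nn aE]]].
exists k => //; apply: (uup _ _ (uI _ _ uK ua) (simple_principal k)) => x [Kx xa].
rewrite /principal_ideal /=; move: xa; rewrite /principal_ideal /= aE => xkn.
by rewrite -(meet_idPl xkn) meetUr (meetC x n) nn // joinx0 leIr.
Qed.

Lemma in_point_inj u v : in_point u = in_point v -> u = v.
Proof.
move=> uv; suff E : dual_point u = dual_point v.
  case: u v E {uv} => u pu [v pv] /= E; subst v.
  by congr DualPoint; exact: Prop_irrelevance.
by apply/seteqP; split=> K; rewrite !dual_pointE uv.
Qed.

(** Otherwise the filter generated by [u] and [ideal_neg K] would be proper and
    larger than [u]: an ideal that is disjoint from [ideal_neg K] is included
    in the simple ideal [K]. *)
Lemma ultrafilter_neg u K :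
  simple_ideal K -> ~ dual_point u K -> dual_point u (ideal_neg K).
Proof.
move=> sK nuK; have [[[[uS uT uI uup] u0] maxu] _] := dual_pointP u.
pose v := [set L | simple_ideal L /\
                   exists2 M, dual_point u M & (M `&` ideal_neg K)%classic `<=` L].
rewrite -(maxu v).
- by split; [exact: simple_ideal_neg|exists setT => // x []].
- split.
    split.
    + by move=> L [].
    + by split; [exact: simple_idealT|exists setT].
    + move=> L L' [sL [M uM ML]] [sL' [M' uM' ML']].
      split; first exact: simple_idealI.
      exists (M `&` M')%classic; first exact: uI.
      by move=> x [[Mx M'x] nx]; split; [apply: ML|apply: ML'].
    + move=> L L' [sL [M uM ML]] sL' LL'; split=> //; exists M => //.
      exact: subset_trans ML LL'.
  (* Were the filter improper, some [M] in [u] would be included in [K]. *)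
  move=> [_ [M uM MN0]]; apply: nuK; apply: (uup _ _ uM sK) => m Mm.
  have /simple_idealP[_ /(_ m)[k [n [Kk nn mE]]]] := sK.
  have [[_ Mle _] _] := uS _ uM.
  have /MN0 n0 : (M `&` ideal_neg K)%classic n.
    by split=> //; apply: Mle Mm; rewrite mE leUr.
  by rewrite mE n0 joinx0.
- by move=> L uL; split; [exact: uS|exists L => // x []].
Qed.

Lemma prime_in_point u : prime_filter (in_point u).
Proof.
have [[[[uS uT uI uup] u0] _] ex] := dual_pointP u.
have up a b : a <= b -> in_point u a -> in_point u b.
  move=> ab ua; apply: (uup _ _ ua (simple_principal b)) => x.
  by rewrite /principal_ideal /= => /le_trans; apply.
split=> //.
- move=> ubot; apply: u0; suff <- : principal_ideal (\bot : I) = [set \bot] by [].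
  by apply/seteqP; split=> x; rewrite /principal_ideal /= lex0 => /eqP.
- move=> a b ua ub; apply: (uup _ _ (uI _ _ ua ub) (simple_principal _)) => x [xa xb].
  by rewrite /principal_ideal /= lexI xa xb.
- move=> a b uab; have [ua|/ultrafilter_neg una] := pselect (in_point u a).
    by left.
  right; apply: (uup _ _ (uI _ _ (una (simple_principal a)) uab) (simple_principal b)).
  move=> x [nx xab]; rewrite /principal_ideal /=.
  have xa : x `&` a = \bot by apply: nx; rewrite /principal_ideal /=.
  by rewrite -(meet_idPl xab) meetUr xa join0x leIr.
Qed.

(** The simple ideals that meet a prime filter [P] form an ultrafilter: if [K]
    misses [P], splitting an element of [P] along [K] shows that [ideal_neg K]
    meets [P], so that [K] cannot be added. *)
Lemma point_of_prime_filter P : prime_filter P -> exists u, in_point u = P.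
Proof.
move=> [[p Pp] P0 Pup PI PU].
pose w := [set K | simple_ideal K /\ exists2 a, K a & P a].
have wprincipal a : w (principal_ideal a) <-> P a.
  split=> [[_ [b ba Pb]]|Pa]; first exact: Pup ba Pb.
  by split; [exact: simple_principal|exists a => //; exact: lexx].
have wP : simple_ultrafilter w /\ exists a, w (principal_ideal a).
  split; last by exists p; apply/wprincipal.
  split.
    split; last by move=> [_ [a -> /P0]].
    split.
    - by move=> K [].
    - by split; [exact: simple_idealT|exists p].
    - move=> K L [sK [a Ka Pa]] [sL [b Lb Pb]]; split; first exact: simple_idealI.
      exists (a `&` b); last exact: PI.
      have [[_ Kle _] _] := sK; have [[_ Lle _] _] := sL.
      by split; [apply: Kle Ka; exact: leIl|apply: Lle Lb; exact: leIr].
    - by move=> K L [_ [a Ka Pa]] sL KL; split=> //; exists a => //; exact: KL.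
  move=> v [[vS _ vI _] v0] wv; apply/seteqP; split=> // K vK.
  have sK := vS _ vK; split=> //.
  have /simple_idealP[_ /(_ p)[k [n [Kk nn pE]]]] := sK.
  have [Pk|Pn] : P k \/ P n by apply: PU; rewrite -pE.
    by exists k.
  have vN : v (ideal_neg K).
    by apply: wv; split; [exact: simple_ideal_neg|exists n].
  exfalso; apply: v0; suff <- : (K `&` ideal_neg K)%classic = [set \bot].
    exact: vI.
  apply/seteqP; split=> [x [Kx /(_ x Kx)]|_ ->]; first by rewrite meetxx.
  have [[K0 _ _] _] := sK; have [N0 _ _] := ideal_ideal_neg K.
  by split.
exists (DualPoint wP); apply/seteqP; split=> a /wprincipal //.
Qed.

(** This plays the part of the compactness of the basic set of [a]: if the
    basic sets of the elements of an ideal cover it, the ideal contains [a]. *)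
Lemma exists_point_avoiding (B : set I) a : ideal B -> ~ B a ->
  exists2 u, in_point u a & forall b, B b -> ~ in_point u b.
Proof.
move=> idB nBa; have [P [primeP Pa PB0]] := prime_filter_exists idB nBa.
have [u uP] := point_of_prime_filter primeP.
exists u; rewrite uP // => b Bb Pb.
by have : (P `&` B)%classic b by []; rewrite PB0.
Qed.

Lemma exists_point_in a : a <> \bot -> exists u, in_point u a.
Proof.
move=> a0; have [||u ua _] := @exists_point_avoiding [set \bot] a; last by exists u.
  split=> //= [b c cb b0|b c -> ->]; last by rewrite joinxx.
  by apply/eqP; rewrite -lex0 -b0.
by [].
Qed.

Lemma leP_points a b : (forall u, in_point u a -> in_point u b) -> a <= b.
Proof.
move=> ab; apply: contrapT => nab.
have [u ua ub] := exists_point_avoiding (ideal_principal b) nab.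
exact/(ub b _ (ab _ ua))/lexx.
Qed.

Lemma in_point_up u a b : a <= b -> in_point u a -> in_point u b.
Proof. by have [_ _ + _ _] := prime_in_point u; apply. Qed.

Lemma in_point_meet u a b :
  in_point u (a `&` b) <-> in_point u a /\ in_point u b.
Proof.
have [_ _ _ uI _] := prime_in_point u; split=> [uab|[]]; last exact: uI.
by split; apply: in_point_up uab; [exact: leIl|exact: leIr].
Qed.

Lemma in_point_join u a b :
  in_point u (a `|` b) <-> in_point u a \/ in_point u b.
Proof.
have [_ _ _ _ uU] := prime_in_point u; split=> [/uU//|].
by case; apply: in_point_up; [exact: leUl|exact: leUr].
Qed.

Lemma in_point_bot u : ~ in_point u \bot.
Proof. by have [] := prime_in_point u. Qed.

Lemma in_point_ex u : exists a, in_point u a.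
Proof. by have [] := prime_in_point u. Qed.

(** Principal ideals suffice as a base of the topology, since by [dual_pointE] a
    simple ideal in [u] contains a principal ideal in [u]. *)
Lemma nbhs_dualP u (U : set (dual_space I)) :
  nbhs u U <-> exists2 a, in_point u a & [set v | in_point v a] `<=` U.
Proof.
split=> [|[a ua aU]].
  rewrite nbhsE => -[V [[D DS <-] [K DK uK]] VU].
  have /dual_pointE[sK [a Ka ua]] := uK.
  exists a => // v va; apply: VU; exists K => //.
  by apply/dual_pointE; split=> //; exists a.
rewrite nbhsE; exists [set v | in_point v a] => //; split=> //.
exists [set principal_ideal a] => [_ ->|]; first exact: simple_principal.
by rewrite bigcup_set1.
Qed.

End Points.

(** * Topological embeddings *)

Section Embeddings.
Context (S T : topologicalType).

Definition embedding (e : S -> T) :=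
  [/\ injective e, continuous e &
      forall x U, nbhs x U -> exists2 V, nbhs (e x) V & e @^-1` V `<=` U].

Lemma homeomorphic_set_typeP (F : set T) :
  homeomorphic S (set_type F) <-> exists2 e, embedding e & range e = F.
Proof.
split=> [[h [g [hK gK hc gc]]]|[e [einj ec eind] <-]].
  exists (set_val \o h); last first.
    apply/seteqP; split=> [_ [x _ <-]|y Fy]; first exact: set_valP.
    by exists (g (exist _ y (mem_set Fy))) => //=; rewrite gK.
  split.
  - by apply: inj_comp (can_inj hK); exact: val_inj.
  - move=> x; apply: continuous_comp; [exact: hc|exact: initial_continuous].
  - move=> x U xU; have : nbhs (h x) (g @^-1` U) by apply: gc; rewrite hK.
    rewrite nbhsE => -[_ [[W oW <-] Whx] WU].
    exists W; first exact: open_nbhs_nbhs.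
    by move=> y Wy; rewrite -(hK y); exact: WU.
pose h x : set_type (range e) := exist _ (e x) (mem_set (imageT e x)).
have gP (y : set_type (range e)) : exists x, e x = val y.
  by have [x _ <-] := set_valP y; exists x.
have [g gE] := choice gP; exists h, g; split.
- by move=> x; apply: einj; rewrite gE.
- by move=> y; apply: val_inj => /=; rewrite gE.
- by apply/continuous_comp_initial => x; exact: ec.
- move=> y U gyU; have [V] := eind _ _ gyU.
  rewrite gE => yV VU.
  have : nbhs y (set_val @^-1` V) by exact: initial_continuous.
  by apply: filterS => z Vz; apply: VU; rewrite /= gE.
Qed.

End Embeddings.

(** * From regular closed embeddings to homomorphisms *)

Section RegularEmbeddingHomomorphism.
Context (d d' : Order.disp_t).
Context (I : bDistrLatticeType d) (J : bDistrLatticeType d').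
Hypotheses (hI : generalized_boolean I) (hJ : generalized_boolean J).
Context (e : dual_space J -> dual_space I).
Hypotheses (e_emb : embedding e) (e_reg : regclosed (range e)).
Implicit Types (a : I) (b : J) (u : dual_space I) (v w : dual_space J).

Lemma embedding_in_point v a : in_point (e v) a ->
  exists2 b, in_point v b & forall w, in_point w b -> in_point (e w) a.
Proof.
move=> va; have [_ ec _] := e_emb.
have : nbhs (e v) [set u | in_point u a] by apply/(nbhs_dualP hI); exists a.
by move=> /ec /(nbhs_dualP hJ)[b vb bP]; exists b.
Qed.

Lemma embedding_in_point_open v b : in_point v b ->
  exists2 a, in_point (e v) a & forall w, in_point (e w) a -> in_point w b.
Proof.
move=> vb; have [_ _ eind] := e_emb.
have [|V /(nbhs_dualP hI)[a va aV] VU] := eind v [set w | in_point w b].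
  by apply/(nbhs_dualP hJ); exists b.
by exists a => // w wa; apply: VU; exact: aV.
Qed.

Lemma out_of_range u : ~ range e u ->
  exists2 a, in_point u a & forall v, ~ in_point (e v) a.
Proof.
move=> nu; have cl : closed (range e) by rewrite -e_reg; exact: closed_closure.
have : nbhs u (~` range e).
  by apply: open_nbhs_nbhs; split=> //; exact: closed_openC.
by move=> /(nbhs_dualP hI)[a ua aP]; exists a => // v /aP; apply; exists v.
Qed.

(** A regular closed set is the closure of its interior, so the nonempty
    relatively open image of a basic set meets this interior. *)
Lemma nonempty_interior b : b <> \bot ->
  exists2 a, a <> \bot &
    forall u, in_point u a -> exists2 v, e v = u & in_point v b.
Proof.
move=> /(exists_point_in hJ)[v /embedding_in_point_open[a va ab]].
have : closure (range e)° (e v) by rewrite e_reg; exists v.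
have /[swap]/[apply] : nbhs (e v) [set u | in_point u a].
  by apply/(nbhs_dualP hI); exists a.
move=> [u [/(nbhs_dualP hI)[c uc cE] ua]].
exists (c `&` a).
  by move=> ca0; apply: (in_point_bot hI (u := u)); rewrite -ca0; apply/in_point_meet.
move=> _ /(in_point_meet hI)[/cE[w _ <-] wa]; exists w => //; exact: ab.
Qed.

(** The preimage of a basic set is compact open, hence basic.  The [c] for which
    some basic set fits between the preimages of the basic sets of [c] and [a]
    form an ideal, and a point [u] in the basic set of [a] and avoiding this
    ideal is impossible: outside the range a neighbourhood of [u] misses the
    range, and inside the range continuity and openness of [e] onto its range
    provide such a [c] in [u]. *)
Lemma preimage_principal a : exists b, forall v, in_point v b <-> in_point (e v) a.
Proof.
pose C := [set c : I | exists2 b, (forall v, in_point (e v) c -> in_point v b) &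
                                  (forall v, in_point v b -> in_point (e v) a)].
have idC : ideal C.
  split.
  - by exists \bot => v /(in_point_bot _).
  - move=> c c' c'c [b cb ba]; exists b => // v vc'.
    by apply: cb; apply: in_point_up vc'.
  - move=> c c' [b cb ba] [b' cb' b'a]; exists (b `|` b') => v.
      by move=> /(in_point_join hI)[/cb|/cb'] ?; apply/(in_point_join hJ); [left|right].
    by move=> /(in_point_join hJ)[/ba|/b'a].
have [[b ab ba]|/(exists_point_avoiding hI idC)[u ua uC]] := pselect (C a).
  by exists b => v; split=> [/ba|/ab].
exfalso; have [[v _ vu]|/out_of_range[c uc cE]] := pselect (range e u); last first.
  by apply: (uC c) => //; exists \bot => v; [move=> /cE|move=> /(in_point_bot hJ)].
move: ua uC; rewrite -vu => /embedding_in_point[b vb ba] uC.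
have [c vc cb] := embedding_in_point_open vb.
by apply: (uC c) => //; exists b.
Qed.

(** Each basic set of the dual of [J] is compact and a union of preimages of
    basic sets of the dual of [I]; compactness is used through an ideal as in
    [preimage_principal]. *)
Lemma preimage_principal_surj b :
  exists a, forall v, in_point v b <-> in_point (e v) a.
Proof.
pose C := [set c : J | exists2 a, (forall v, in_point v c -> in_point (e v) a) &
                                  (forall v, in_point (e v) a -> in_point v b)].
have idC : ideal C.
  split.
  - by exists \bot => v /(in_point_bot _).
  - move=> c c' c'c [a ca ab]; exists a => // v vc'.
    by apply: ca; apply: in_point_up vc'.
  - move=> c c' [a ca ab] [a' ca' a'b]; exists (a `|` a') => v.
      by move=> /(in_point_join hJ)[/ca|/ca'] ?; apply/(in_point_join hI); [left|right].
    by move=> /(in_point_join hI)[/ab|/a'b].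
have [[a ba ab]|/(exists_point_avoiding hJ idC)[v vb vC]] := pselect (C b).
  by exists a => v; split=> [/ba|/ab].
exfalso; have [a va ab] := embedding_in_point_open vb.
have [c vc ca] := embedding_in_point va.
by apply: (vC c) => //; exists a.
Qed.

Lemma homomorphism_of_regular_embedding :
  exists phi : {lmorphism I -> J},
     [/\ phi \bot = \bot, set_surj [set: I]%classic [set: J]%classic phi &
         preserves_existing_meets phi].
Proof.
have [f fE] := choice preimage_principal.
have f_ext b b' : (forall v, in_point v b <-> in_point v b') -> b = b'.
  by move=> bb'; apply: le_anti; apply/andP; split; apply: (leP_points hJ) => v /bb'.
have fI a a' : f (a `&` a') = f a `&` f a'.
  by apply: f_ext => v; rewrite fE !in_point_meet// !fE.
have fU a a' : f (a `|` a') = f a `|` f a'.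
  by apply: f_ext => v; rewrite fE !in_point_join// !fE.
have fle a a' : a <= a' -> f a <= f a'.
  by move=> /meet_idPl <-; rewrite fI leIr.
have f0 : f \bot = \bot.
  by apply: f_ext => v; rewrite fE; split=> /(in_point_bot _).
pose fo := Order.isOrderMorphism.Build d I d' J f fle.
pose fm := Order.isMeetLatticeMorphism.Build d I d' J f fI.
pose fj := Order.isJoinLatticeMorphism.Build d I d' J f fU.
pose phi : {lmorphism I -> J} := HB.pack f fo fm fj.
exists phi; split=> //.
  move=> b _; have [a ba] := preimage_principal_surj b.
  by exists a => //; apply: f_ext => v; rewrite fE ba.
move=> A a [Aa aA]; split=> [_ [c Ac <-]|b bA].
  exact/fle/Aa.
(* The part [c] of [b] disjoint from [f a] must vanish. *)
have [c [cb ca bE]] := relative_complement hJ b (f a).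
suff c0 : c = \bot by rewrite bE c0 joinx0 leIr.
apply: contrapT => /nonempty_interior[x x0 xc]; apply: x0.
have xle y : A y -> x <= y.
  move=> Ay; apply: (leP_points hI) => u /xc[v <- vc]; apply/fE.
  apply: (in_point_up hJ) vc; apply: (le_trans cb); apply: bA; exact: imageP.
apply: contrapT => /(exists_point_in hI)[u ux]; have [v vu vc] := xc _ ux.
apply: (in_point_bot hJ (u := v)); rewrite -ca; apply/in_point_meet => //.
split=> //; apply/fE; rewrite vu; apply: (in_point_up hI) ux; exact: aA.
Qed.

End RegularEmbeddingHomomorphism.

(** * From homomorphisms to regular closed embeddings *)

Section HomomorphismRegularEmbedding.
Context (d d' : Order.disp_t).
Context (I : bDistrLatticeType d) (J : bDistrLatticeType d').
Hypotheses (hI : generalized_boolean I) (hJ : generalized_boolean J).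
Context (phi : {lmorphism I -> J}).
Hypotheses (phi0 : phi \bot = \bot).
Hypotheses (phi_surj : set_surj [set: I]%classic [set: J]%classic phi).
Hypotheses (phi_meets : preserves_existing_meets phi).
Implicit Types (a k : I) (b : J) (u : dual_space I) (v w : dual_space J).

Let phiE b : exists a, phi a = b.
Proof. by have /phi_surj[a _ ab] : [set: J]%classic b by []; exists a. Qed.

Lemma preimage_point v : exists u, forall a, in_point u a <-> in_point v (phi a).
Proof.
have [|u uE] := @point_of_prime_filter _ _ hI [set a | in_point v (phi a)].
  split => /=.
  - have [b vb] := in_point_ex hJ v; have [a ab] := phiE b.
    by exists a; rewrite ab.
  - by rewrite phi0; exact: in_point_bot.
  - by move=> a a' aa'; apply: in_point_up => //; exact: omorph_le.
  - by move=> a a' va va'; rewrite omorphI; apply/in_point_meet.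
  - by move=> a a'; rewrite omorphU => /(in_point_join hJ).
by exists u => a; rewrite uE.
Qed.

(** A prime filter avoiding the kernel is saturated for [phi]: if
    [phi a = phi a'], the difference of [a] and [a'] is in the kernel, so [a']
    is in the filter when [a] is.  Its image is then a prime filter of [J]. *)
Lemma image_point u : (forall k, phi k = \bot -> ~ in_point u k) ->
  exists v, forall a, in_point v (phi a) <-> in_point u a.
Proof.
move=> uker; have phi_eq a a' : phi a = phi a' -> in_point u a -> in_point u a'.
  move=> aa' ua; have [c [ca ca' aE]] := relative_complement hI a a'.
  move: ua; rewrite aE => /(in_point_join hI)[/(in_point_meet hI)[]//|].
  have /uker// : phi c = \bot.
  have phica' : phi c <= phi a' by rewrite -aa' omorph_le.
  by rewrite -phi0 -ca' omorphI (meet_idPl phica').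
pose P := [set b | exists2 a, in_point u a & phi a = b].
have PE a : P (phi a) <-> in_point u a.
  by split=> [[a' ua' /phi_eq]|ua]; [apply|exists a].
have [|v vP] := @point_of_prime_filter _ _ hJ P; last first.
  by exists v => a; rewrite vP.
split.
- by have [a ua] := in_point_ex hI u; exists (phi a), a.
- by rewrite -phi0 => /PE /(in_point_bot hI).
- move=> b b'; have [a <-] := phiE b; have [a' <-] := phiE b'.
  move=> /meet_idPl; rewrite -omorphI => aa' /PE.
  by move/(phi_eq _ _ (esym aa')) => /(in_point_meet hI)[_ /PE].
- move=> b b'; have [a <-] := phiE b; have [a' <-] := phiE b'.
  by rewrite -omorphI !PE in_point_meet.
- move=> b b'; have [a <-] := phiE b; have [a' <-] := phiE b'.
  by rewrite -omorphU !PE in_point_join.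
Qed.

(** This is where the preservation of meets enters: if no such [c] existed, the
    differences of [a] with the kernel elements would have meet [\bot], while
    [phi] maps each of them to [phi a]. *)
Lemma kernel_free_below a : phi a <> \bot ->
  exists c, [/\ c <= a, c <> \bot & forall k, phi k = \bot -> c `&` k = \bot].
Proof.
move=> phia; apply: contrapT => nfree; apply: phia.
pose A := [set x | exists k, [/\ phi k = \bot, x <= a & a = (a `&` k) `|` x]].
have inf0 : infimums A \bot.
  split=> [x _|c cA]; first exact: le0x.
  rewrite lex0; apply/eqP; apply: contrapT => c0; apply: nfree; exists c; split=> //.
    by apply: cA; exists \bot; rewrite meetx0 join0x.
  move=> k k0; have [x [xa xk aE]] := relative_complement hI a k.
  by apply/eqP; rewrite -lex0 -xk leI2 //; apply: cA; exists k.
have [_ /(_ (phi a))] := phi_meets inf0; rewrite phi0 => phia.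
apply/eqP; rewrite -lex0; apply: phia => _ [x [k [k0 xa aE]] <-].
have phiaE : phi a = (phi a `&` phi k) `|` phi x.
  by rewrite -omorphI -omorphU -aE.
by rewrite phiaE k0 meetx0 join0x.
Qed.

(** The range consists of the points avoiding the kernel; a basic neighbourhood
    of a point of the range contains the nonempty basic set provided by
    [kernel_free_below], which avoids the kernel and is thus interior. *)
Lemma regular_embedding_of_homomorphism :
  exists2 e : dual_space J -> dual_space I, embedding e & regclosed (range e).
Proof.
have [e eE] := choice preimage_point.
have rangeE : range e = [set u | forall k, phi k = \bot -> ~ in_point u k].
  apply/seteqP; split=> [_ [v _ <-] k k0|u /image_point[v vu]].
    by rewrite eE k0; exact: in_point_bot.
  exists v => //; apply: (in_point_inj hI); apply/seteqP.
  by split=> a /=; rewrite eE vu.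
exists e.
  split.
  - move=> v w vw; apply: (in_point_inj hJ); apply/seteqP.
    by split=> b /=; have [a <-] := phiE b; rewrite -!eE vw.
  - move=> v U /(nbhs_dualP hI)[a /eE va aU]; apply/(nbhs_dualP hJ).
    by exists (phi a) => // w wa; apply: aU; apply/eE.
  - move=> v U /(nbhs_dualP hJ)[b]; have [a <-] := phiE b => va aU.
    exists [set u | in_point u a].
      by apply/(nbhs_dualP hI); exists a => //; apply/eE.
    by move=> w /eE; exact: aU.
rewrite /regclosed; apply/seteqP; split=> [u clu|_ [v _ <-] U].
  rewrite rangeE => k k0 uk.
  have [|x []] := clu [set u | in_point u k].
    by apply/(nbhs_dualP hI); exists k.
  by move=> /interior_subset; rewrite rangeE => /(_ _ k0).
move=> /(nbhs_dualP hI)[a va aU].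
have [|c [ca c0 cker]] := @kernel_free_below a.
  by move=> phia; move/eE: va; rewrite phia => /(in_point_bot hJ).
have [u uc] := exists_point_in hI c0; exists u; split; last first.
  by apply: aU; exact: in_point_up uc.
apply/(nbhs_dualP hI); exists c => // w wc; rewrite rangeE => k k0 wk.
by apply: (in_point_bot hI (u := w)); rewrite -(cker _ k0); apply/in_point_meet.
Qed.

End HomomorphismRegularEmbedding.

Theorem theorem4p10 (d d' : Order.disp_t)
    (I : bDistrLatticeType d) (J : bDistrLatticeType d')
    (hI : generalized_boolean I) (hJ : generalized_boolean J) :
  (exists F : set (dual_space I),
     regclosed F /\ homeomorphic (dual_space J) (set_type F)) <->
  (exists phi : {lmorphism I -> J},
     [/\ phi \bot%O = \bot%O,
         set_surj [set: I]%classic [set: J]%classic phi &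
         preserves_existing_meets phi]).
Proof.
split=> [[F [rF /homeomorphic_set_typeP[e ee eF]]]|[phi [phi0 phis phim]]].
  by apply: homomorphism_of_regular_embedding ee _ => //; rewrite eF.
have [e ee re] := regular_embedding_of_homomorphism hI hJ phi0 phis phim.
by exists (range e); split=> //; apply/homeomorphic_set_typeP; exists e.
Qed.
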